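(* Let $\mathcal T$ be the set of ordered pairs $(a,b)$ of positive integers with $a<b$ for which $9a^2b^2-12(a+b)^2$ is a square (equivalently, the pairs $a<b$ for which there is an Eisenstein lattice equable parallelogram with sides $a\sqrt3,b\sqrt3$). Make $\mathcal T$ the vertex set of a simple graph by joining two distinct elements $(a,b)$ and $(a',b')$ by an edge if and only if there exist $x\in\mathcal S$ and $i\in\{1,2\}$ with $\pi(x)=(a,b)$ and $\pi(\phi_i(x))=(a',b')$, where $\mathcal S,\pi,\phi_1,\phi_2$ are as defined in the context. Then this graph is an infinite tree in which every vertex has degree $4$, except for the vertex $(2,4)$ (the root), which has degree $3$. Moreover, every element of $\mathcal T$ can be obtained from $(2,4)$ by successive applications of the four maps $\varphi_1,\varphi_2,\psi_1,\psi_2:\mathcal T\to\mathcal T$ defined in the context.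
   Context: A planar polygon is equable if its perimeter equals its area; an Eisenstein lattice equable parallelogram (ELEP) is an equable parallelogram with all vertices in $\mathbb{Z}[\omega]$, $\omega=-\frac12+i\frac{\sqrt3}{2}$. $\mathcal S$ is the set of triples $(s,t,u)$ of positive integers, with $s,t$ coprime, satisfying $s^2+3t^2+2u^2=6stu$. The involutions $\phi_1,\phi_2,\phi_3:\mathcal S\to\mathcal S$ are $$\phi_1(s,t,u)=(6tu-s,t,u),\quad \phi_2(s,t,u)=(s,2su-t,u),\quad \phi_3(s,t,u)=(s,t,3st-u).$$ The map $\pi:\mathcal S\to\mathcal T$ is $$\pi(s,t,u)=\left(3st-\sqrt{9s^2t^2-2(s^2+3t^2)},\ 3st+\sqrt{9s^2t^2-2(s^2+3t^2)}\right).$$ It is well defined and surjective, and each fibre of $\pi$ consists of two points interchanged by $\phi_3$. (Thus the graph on $\mathcal T$ is obtained from the graph on $\mathcal S$, whose edges join distinct solutions exchanged by some $\phi_i$, by contracting the $\phi_3$-edges.) For $(a,b)\in\mathcal T$, write $a=2q$, $b=2r$ ($a,b$ are always even); there are unique coprime positive integers $s,t$ such that $(s,t,q)\in\mathcal S$ and $\pi(s,t,q)=(a,b)$, and then also $(s,t,r)\in\mathcal S$. For $i=1,2$ define $$\varphi_i(a,b)=\pi(\phi_i(s,t,q)),\qquad \psi_i(a,b)=\pi(\phi_i(s,t,r)).$$ *)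

(* Defs.v *)
From mathcomp Require Import all_boot all_order all_algebra all_field.
From mathcomp Require Import boolp classical_sets functions cardinality.
From mathcomp Require Import ring lra zify.

Set Implicit Arguments.
Unset Strict Implicit.
Unset Printing Implicit Defensive.

Import Order.TTheory GRing.Theory Num.Theory.

Local Open Scope classical_set_scope.
Local Open Scope ring_scope.

(* Simple graphs on arbitrary (possibly infinite) vertex sets *)

Record simple_graph (V : eqType) := SimpleGraph {
  adj : rel V;
  adj_sym : symmetric adj;
  adj_irr : irreflexive adj
}.

Section Graphs.
Variables (V : eqType) (G : simple_graph V).

Definition connected_graph : Prop :=
  forall v w : V, exists2 p : seq V, path (adj G) v p & last v p = w.

(* [ucycle] also accepts [:: v; w] for an edge vw, hence the bound on the
   length. *)
Definition acyclic_graph : Prop :=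
  forall c : seq V, ucycle (adj G) c -> ~~ (2 < size c)%N.

Definition is_tree : Prop :=
  [/\ (exists v : V, True), connected_graph & acyclic_graph].

Definition has_degree (v : V) (d : nat) : Prop :=
  ([set w | adj G v w] #= `I_d)%card.

End Graphs.

(* [generated F v0 v]: v is obtained from v0 by finitely many successive
   applications of maps in F. *)
Inductive generated (V : Type) (F : set (V -> V)) (v0 : V) : V -> Prop :=
| generated_base : generated F v0 v0
| generated_step (f : V -> V) (v : V) :
    F f -> generated F v0 v -> generated F v0 (f v).

(* The plane is modelled by the field [algC] of algebraic numbers, which
   contains Z[omega]. *)

Definition omega : algC := - (1 / 2) + 'i * (sqrtC 3 / 2).

Definition eisenstein : set algC :=
  [set z | exists m n : int, z = m%:~R + n%:~R * omega].

Definition perimeter4 (P Q R S : algC) : algC :=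
  `|Q - P| + `|R - Q| + `|S - R| + `|P - S|.

(* PQRS is a parallelogram, possibly degenerate *)
Definition parallelogram (P Q R S : algC) : Prop := Q - P = R - S.

(* Im (conj v * w) is the signed area spanned by v and w *)
Definition parallelogram_area (P Q R S : algC) : algC :=
  `|'Im ((Q - P)^* * (S - P))|.

Definition is_ELEP (P Q R S : algC) : Prop :=
  [/\ [/\ eisenstein P, eisenstein Q, eisenstein R & eisenstein S],
      parallelogram P Q R S,
      parallelogram_area P Q R S != 0 &
      perimeter4 P Q R S = parallelogram_area P Q R S].

Definition ELEP_with_sides (l m : algC) : Prop :=
  exists P Q R S : algC,
    [/\ is_ELEP P Q R S, `|Q - P| = l & `|S - P| = m].

Definition calT : set (int * int) :=
  [set p | let: (a, b) := p in
     [/\ 0 < a, 0 < b, a < b &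
         exists c : int, 9 * a ^+ 2 * b ^+ 2 - 12 * (a + b) ^+ 2 = c ^+ 2]].

Definition calS : set (int * int * int) :=
  [set x | let: (s, t, u) := x in
     [/\ [/\ 0 < s, 0 < t & 0 < u], coprimez s t &
         s ^+ 2 + 3 * t ^+ 2 + 2 * u ^+ 2 = 6 * s * t * u]].

Definition phi1_fun (x : int * int * int) : int * int * int :=
  let: (s, t, u) := x in (6 * t * u - s, t, u).

Definition phi2_fun (x : int * int * int) : int * int * int :=
  let: (s, t, u) := x in (s, 2 * s * u - t, u).

Lemma calS_sqr s t u : calS (s, t, u) ->
  s ^+ 2 = 6 * s * t * u - 3 * t ^+ 2 - 2 * u ^+ 2.
Proof. by move=> [_ _ <-]; ring. Qed.

Lemma phi1_funS x : calS x -> calS (phi1_fun x).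
Proof.
move: x => [[s t] u] Sx; have e := calS_sqr Sx.
move: Sx => [[s0 t0 u0] cst _] /=; split; last by move: e; lia.
- have : 0 < s * (6 * t * u - s).
    have -> : s * (6 * t * u - s) = 3 * t ^+ 2 + 2 * u ^+ 2 by move: e; lia.
    by rewrite addr_gt0 // mulr_gt0 // exprn_gt0.
  by rewrite pmulr_rgt0.
- have -> : 6 * t * u - s = (6 * u) * t + (- s) by ring.
  by rewrite coprimez_sym /coprimez gcdzMDl gcdzN -/(coprimez t s) coprimez_sym.
Qed.

Lemma phi2_funS x : calS x -> calS (phi2_fun x).
Proof.
move: x => [[s t] u] Sx; have e := calS_sqr Sx.
move: Sx => [[s0 t0 u0] cst _] /=; split; last by move: e; lia.
- have : 0 < 3 * t * (2 * s * u - t).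
    have -> : 3 * t * (2 * s * u - t) = s ^+ 2 + 2 * u ^+ 2 by move: e; lia.
    by rewrite addr_gt0 // ?mulr_gt0 // exprn_gt0.
  by rewrite pmulr_rgt0 ?mulr_gt0.
- have -> : 2 * s * u - t = (2 * u) * s + (- t) by ring.
  by rewrite /coprimez gcdzMDl gcdzN -/(coprimez s t).
Qed.

Definition phi1 (x : calS) : calS :=
  exist _ (phi1_fun (val x)) (mem_set (phi1_funS (set_mem (valP x)))).

Definition phi2 (x : calS) : calS :=
  exist _ (phi2_fun (val x)) (mem_set (phi2_funS (set_mem (valP x)))).

Lemma phi1K : involutive phi1.
Proof.
by move=> [[[s t] u] h]; apply: val_inj; rewrite /= subKr.
Qed.

Lemma phi2K : involutive phi2.
Proof.
by move=> [[[s t] u] h]; apply: val_inj; rewrite /= subKr.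
Qed.

Definition pi_alg (x : int * int * int) : algC * algC :=
  let: (s, t, u) := x in
  let r : algC :=
    sqrtC (9 * s ^+ 2 * t ^+ 2 - 2 * (s ^+ 2 + 3 * t ^+ 2))%:~R in
  ((3 * s * t)%:~R - r, (3 * s * t)%:~R + r).

(* On calS both coordinates of [pi_alg] are integers (lemma [pi_funE]), so
   that [Num.floor] only changes their type. *)
Definition pi_fun (x : int * int * int) : int * int :=
  (Num.floor (pi_alg x).1, Num.floor (pi_alg x).2).

Lemma pi_algE s t u : calS (s, t, u) ->
  pi_alg (s, t, u) = ((3 * s * t - `|3 * s * t - 2 * u|)%:~R,
                      (3 * s * t + `|3 * s * t - 2 * u|)%:~R).
Proof.
move=> /calS_sqr e; rewrite /pi_alg.
have -> : 9 * s ^+ 2 * t ^+ 2 - 2 * (s ^+ 2 + 3 * t ^+ 2)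
        = `|3 * s * t - 2 * u| ^+ 2 by rewrite real_normK ?num_real //; move: e; lia.
by rewrite rmorphXn /= sqrCK ?ler0z // rmorphB rmorphD.
Qed.

Lemma pi_funE x : calS x ->
  pi_alg x = ((pi_fun x).1%:~R, (pi_fun x).2%:~R).
Proof.
move: x => [[s t] u] Sx.
by rewrite /pi_fun (pi_algE Sx) /= !intrKfloor.
Qed.

Lemma pi_funS x : calS x -> calT (pi_fun x).
Proof.
move: x => [[s t] u] Sx; have [[s0 t0 u0] cst _] := Sx.
have e := calS_sqr Sx.
rewrite /pi_fun (pi_algE Sx) /= !intrKfloor.
set d := 3 * s * t - 2 * u.
have dE : `|d| ^+ 2 = 9 * s ^+ 2 * t ^+ 2 - 2 * (s ^+ 2 + 3 * t ^+ 2).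
  by rewrite real_normK ?num_real // /d; move: e; lia.
have st0 : 0 < s * t by rewrite mulr_gt0.
have u'0 : 0 < 3 * s * t - u.
  have : 0 < 2 * u * (3 * s * t - u).
    have -> : 2 * u * (3 * s * t - u) = s ^+ 2 + 3 * t ^+ 2 by move: e; lia.
    by rewrite addr_gt0 ?mulr_gt0 ?exprn_gt0.
  by rewrite pmulr_rgt0 // mulr_gt0.
have d0 : d != 0.
  apply/eqP => d0; move: dE; rewrite d0 normr0 expr0n /= => dE.
  have dvd3s : (3 %| s)%Z.
    have : (3 %| s ^+ 2)%Z.
      apply/dvdzP; exists (s ^+ 2 + 2 * t ^+ 2 - 3 * s ^+ 2 * t ^+ 2).
      by lia.
    by rewrite !dvdzE abszX Euclid_dvdX // andbT.
  have [s' s'E] := dvdzP dvd3s.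
  have dvd3t : (3 %| t)%Z.
    have : (3 %| t ^+ 2)%Z.
      apply/dvdzP; exists (t ^+ 2 + 2 * s' ^+ 2 - 9 * s' ^+ 2 * t ^+ 2).
      by move: dE; rewrite s'E => dE; lia.
    by rewrite !dvdzE abszX Euclid_dvdX // andbT.
  have : (3 %| gcdz s t)%Z by rewrite dvdz_gcd dvd3s.
  by rewrite (eqP cst).
have nd0 : 0 < `|d| by rewrite normr_gt0.
split; [| | by lia |].
- by rewrite /d; lia.
- by lia.
- exists (6 * (s ^+ 2 - 3 * t ^+ 2)).
  have -> : 9 * (3 * s * t - `|d|) ^+ 2 * (3 * s * t + `|d|) ^+ 2
    = 9 * (9 * s ^+ 2 * t ^+ 2 - `|d| ^+ 2) ^+ 2 by ring.
  by rewrite dE; ring.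
Qed.

Definition pi (x : calS) : calT :=
  exist _ (pi_fun (val x)) (mem_set (pi_funS (set_mem (valP x)))).

Lemma calT_root : calT (2, 4).
Proof. by split=> //; exists 12. Qed.

Definition rootT : calT := exist _ (2, 4) (mem_set calT_root).

Lemma calS_111 : calS (1, 1, 1).
Proof. by []. Qed.

Definition rootS : calS := exist _ (1, 1, 1) (mem_set calS_111).

Definition edgeT : rel calT := fun v w =>
  (v != w) && `[< exists2 x : calS, pi x = v &
                    pi (phi1 x) = w \/ pi (phi2 x) = w >].

Lemma edgeT_sym : symmetric edgeT.
Proof.
suff h v w : edgeT v w -> edgeT w v by move=> v w; apply/idP/idP; exact: h.
move=> /andP[vw /asboolP[x xv xw]]; rewrite /edgeT eq_sym vw /=.
by apply/asboolP; case: xw => xw; [exists (phi1 x)|exists (phi2 x)];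
  rewrite ?phi1K ?phi2K //; [left|right].
Qed.

Lemma edgeT_irr : irreflexive edgeT.
Proof. by move=> v; rewrite /edgeT eqxx. Qed.

Definition graphT : simple_graph calT := SimpleGraph edgeT_sym edgeT_irr.

(* For p = (a, b) = (2q, 2r), [liftq p] is the (unique) point (s, t, q) of calS
   above p and [liftr p] is the point (s, t, r). Such points always exist; the
   default value [rootS] of [xget] only serves to make the definitions total. *)
Definition liftq (p : calT) : calS :=
  xget rootS [set x : calS | 2 * (val x).2 = (val p).1 /\ pi x = p].

Definition liftr (p : calT) : calS :=
  xget rootS [set y : calS |
    (val y).1 = (val (liftq p)).1 /\ 2 * (val y).2 = (val p).2].

Definition varphi1 (p : calT) : calT := pi (phi1 (liftq p)).
Definition varphi2 (p : calT) : calT := pi (phi2 (liftq p)).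
Definition psi1 (p : calT) : calT := pi (phi1 (liftr p)).
Definition psi2 (p : calT) : calT := pi (phi2 (liftr p)).

(* Main.v *)
From mathcomp Require Import all_boot all_order all_algebra all_field.
From mathcomp Require Import boolp classical_sets functions cardinality finmap.
From mathcomp Require Import ring lra zify.
Require Import Defs.

Set Implicit Arguments.
Unset Strict Implicit.
Unset Printing Implicit Defensive.

Import Order.TTheory GRing.Theory Num.Theory.
Local Open Scope classical_set_scope.
Local Open Scope ring_scope.

(* If 9a^2b^2 - 12(a+b)^2 = 9d^2 and a + b = 3m, then (ab-d)(ab+d) = 12m^2, and
   unique factorization gives a + b = 3gst and ab = g(s^2+3t^2), that is,
     a^2 + g(s^2+3t^2) = 3gsta.
   Vieta descent in the three variables a, s, t, for fixed g, can only end at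
   g = 2, (s, t, a) = (1, 1, 2).  Hence every (a, b) in T lifts to (s, t, a/2)
   in S, and any such equation with g = 2 has s, t coprime.  The same descent
   carries along a factorization s + t sqrt(-3) = alpha beta in Z[omega] with
   |alpha|^2 equal to a or a/2, which makes unique factorization in Z[omega]
   unnecessary for building an ELEP with sides a sqrt(3), b sqrt(3).
   For the graph, a vertex is determined by the pair (s, t) of its fibre.  With
   the height s t, adjacent vertices have distinct heights, the root is a local
   minimum and every other vertex has exactly one lower neighbour, so the graph
   is a tree. *)

(** * Vieta descent *)

(* In the variables x = 3gs^2, y = 9gt^2, z = 3a^2 the equation of [markov]
   below becomes symmetric. *)
Lemma square_markov_gt4 (x y z : int) : 0 < x -> 0 < y -> 0 < z ->
  (x + y + z) ^+ 2 = x * y * z -> 4 < x.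
Proof.
move=> x0 y0 z0 e; rewrite ltNge; apply/negP => x4.
(* If [x <= 4] then [x*y*z <= 4*y*z <= (y + z)^2 < (x + y + z)^2], a contradiction. *)
have h1 : 0 <= (4 - x) * (y * z) by rewrite mulr_ge0 ?mulr_ge0 ?subr_ge0 // ltW.
have h2 := sqr_ge0 (y - z).
have h3 : 0 < x * (x + 2 * y + 2 * z) by rewrite mulr_gt0 //; lia.
lia.
Qed.

(** Regard [(x + y + z)^2 - x*y*z] as a quadratic in [z]. The reducedness [4*z <= x*y] makes [z] its
    smaller root, so the quadratic is nonnegative at [y <= z]. This gives
    [x*y^2 <= (x + 2*y)^2 <= 9*y^2]. *)
Lemma square_markov_sorted (x y z : int) : 0 < x -> x <= y -> y <= z ->
  (x + y + z) ^+ 2 = x * y * z -> 4 * z <= x * y ->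
  x <= 9 /\ (x = 9 -> y = 9 /\ z = 9).
Proof.
move=> x0 xy yz e zxy.
have z0 : 0 < z by lia.
have h4 : 0 <= z * (x * y - 4 * z) by rewrite mulr_ge0 ?subr_ge0 // ltW.
have zz : z <= x + y.
  rewrite leNgt; apply/negP => h.
  have : 0 < (z - (x + y)) * (3 * z + x + y) by rewrite mulr_gt0 //; lia.
  lia.
(* This product is the value of the quadratic at [y] minus its value, zero, at [z]. Multiplied by
   [z], the second factor becomes [(x + y)^2 - y*z], nonnegative because [z <= x + y]. *)
have h : 0 <= (z - y) * (x * y - 2 * (x + y) - z - y).
  apply: mulr_ge0; first by lia.
  suff: 0 <= z * (x * y - 2 * (x + y) - z - y) by rewrite pmulr_rge0.
  have : 0 <= (x + y) * (x + y - z) by rewrite mulr_ge0 //; lia.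
  have : 0 <= (z - y) * z by rewrite mulr_ge0 //; lia.
  have : 0 <= (x + y - z) * z by rewrite mulr_ge0 //; lia.
  lia.
have h2 : x * y ^+ 2 <= (x + 2 * y) ^+ 2 by lia.
have h3 : 0 <= (y - x) * (x + 5 * y) by rewrite mulr_ge0 //; lia.
have y2 : 0 < y ^+ 2 by rewrite exprn_gt0 //; lia.
have h5 : (x - 9) * y ^+ 2 <= 0 by lia.
have x9 : x <= 9 by move: h5; rewrite pmulr_lle0 // subr_le0.
split=> // x9'; subst x.
have y9 : y = 9.
  apply/eqP; rewrite eq_le xy andbT leNgt; apply/negP => y9.
  have : 0 < (y - 9) * (9 + 5 * y) by rewrite mulr_gt0 //; lia.
  lia.
subst y; split=> //.
have : (z - 9) * (z - 36) = 0 by lia.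
move/eqP; rewrite mulf_eq0 => /orP[] /eqP; lia.
Qed.

Lemma square_markov_min (x y z : int) : 0 < x -> 0 < y -> 0 < z ->
  (x + y + z) ^+ 2 = x * y * z ->
  4 * x <= y * z -> 4 * y <= x * z -> 4 * z <= x * y ->
  [\/ [/\ x = 9, y = 9 & z = 9], x < 9, y < 9 | z < 9].
Proof.
(* By symmetry the first variable may be taken to be the least one. *)
suff H : forall x y z : int, 0 < x -> x <= y -> x <= z ->
    (x + y + z) ^+ 2 = x * y * z -> 4 * y <= x * z -> 4 * z <= x * y ->
    [/\ x = 9, y = 9 & z = 9] \/ x < 9.
  move=> x0 y0 z0 e ex ey ez.
  have [xy|xy] := leP x y; have [xz|xz] := leP x z.
  - have [[? ? ?]|?] : [/\ x = 9, y = 9 & z = 9] \/ x < 9 by exact: H.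
      by constructor 1.
    by constructor 2.
  - have [[? ? ?]|?] : [/\ z = 9, x = 9 & y = 9] \/ z < 9 by apply: H; lia.
      by constructor 1.
    by constructor 4.
  - have [[? ? ?]|?] : [/\ y = 9, x = 9 & z = 9] \/ y < 9 by apply: H; lia.
      by constructor 1.
    by constructor 3.
  - have [yz|yz] := leP y z.
      have [[? ? ?]|?] : [/\ y = 9, x = 9 & z = 9] \/ y < 9 by apply: H; lia.
        by constructor 1.
      by constructor 3.
    have [[? ? ?]|?] : [/\ z = 9, x = 9 & y = 9] \/ z < 9 by apply: H; lia.
      by constructor 1.
    by constructor 4.
move=> {}x {}y {}z x0 xy xz e ey ez.
have [x9 h] : x <= 9 /\ (x = 9 -> y = 9 /\ z = 9).
  have [yz|/ltW yz] := leP y z; first exact: square_markov_sorted.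
  have [] // : x <= 9 /\ (x = 9 -> z = 9 /\ y = 9).
    by apply: square_markov_sorted => //; lia.
  by move=> ? h; split=> // /h[].
have [x9'|nx9] := eqVneq x 9; last by right; lia.
by have [? ?] := h x9'; left.
Qed.

(** For [g = 2] and [a = 2*u] this is twice the equation of [calS]. The factor [g] stays free
    because only the descent identifies it. *)
Definition markov (g s t a : int) : Prop :=
  [/\ 0 < s, 0 < t, 0 < a &
      a ^+ 2 + g * (s ^+ 2 + 3 * t ^+ 2) = 3 * g * s * t * a].

(** The three inequalities say that no Vieta flip decreases the solution. In the symmetric variables
    [Y] is a multiple of 9 and [Z = 3*a^2 > 4] forces [Z >= 12], so the variable below 9 must be
    [X]. Being a multiple of 3 between 4 and 9, it equals 6, whence [g*s^2 = 2]. *)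
Lemma markov_minimal (g s t a : int) : 0 < g -> markov g s t a ->
  2 * a <= 3 * g * s * t -> 2 * s <= 3 * a * t -> 2 * t <= a * s ->
  [/\ g = 2, s = 1, t = 1 & a = 2].
Proof.
move=> g0 [s0 t0 a0 e] ha hs ht.
pose X := 3 * (g * s ^+ 2); pose Y := 9 * (g * t ^+ 2); pose Z := 3 * a ^+ 2.
have X0 : 0 < X by rewrite !mulr_gt0 // exprn_gt0.
have Y0 : 0 < Y by rewrite !mulr_gt0 // exprn_gt0.
have Z0 : 0 < Z by rewrite !mulr_gt0 // exprn_gt0.
have E : (X + Y + Z) ^+ 2 = X * Y * Z.
  have -> : X + Y + Z = 3 * (3 * g * s * t * a) by rewrite -e /X /Y /Z; ring.
  by rewrite /X /Y /Z; ring.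
have sqr_mon (x y : int) : 0 < x -> 2 * x <= y -> 4 * x ^+ 2 <= y ^+ 2.
  move=> x0 xy; rewrite (_ : 4 = 2 ^+ 2) // -exprMn lerXn2r ?nnegrE //.
    by rewrite mulr_ge0 // ltW.
  by apply: le_trans xy; rewrite mulr_ge0 // ltW.
have EX : 4 * X <= Y * Z.
  have := ler_wpM2l (ltW g0) (sqr_mon _ _ s0 hs).
  by clear; rewrite /X /Y /Z; lia.
have EY : 4 * Y <= X * Z.
  have := ler_wpM2l (ltW g0) (sqr_mon _ _ t0 ht).
  by clear; rewrite /X /Y /Z; lia.
have EZ : 4 * Z <= X * Y.
  have := sqr_mon _ _ a0 ha.
  by clear; rewrite /X /Y /Z; lia.
have Z4 : 4 < Z.
  apply: (@square_markov_gt4 Z X Y) => //.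
  by rewrite -addrA addrC -mulrA [Z * _]mulrC.
have X4 : 4 < X.
  apply: (@square_markov_gt4 X Y Z) => //.
have a3 : 9 < Z.
  have a1 : a != 1 by apply/eqP => a1; move: Z4; rewrite /Z a1.
  have : 2 ^+ 2 <= a ^+ 2 by rewrite lerXn2r ?nnegrE //; lia.
  by clear; rewrite /Z; lia.
have [[_ _ Z9]|X9|Y9|Z9] := square_markov_min X0 Y0 Z0 E EX EY EZ.
- by move: a3; rewrite Z9.
- have {X9 X4} gs2 : g * s ^+ 2 = 2 by move: X9 X4; rewrite /X; clear; lia.
  have s1 : s = 1.
    apply/eqP; rewrite eq_le [1 <= s]s0 andbT leNgt; apply/negP => s1.
    have : 2 ^+ 2 <= s ^+ 2 by rewrite lerXn2r ?nnegrE //; lia.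
    move=> s2; have : 0 <= (g - 1) * (s ^+ 2).
      by rewrite mulr_ge0 ?sqr_ge0 //; lia.
    by move: gs2 s2; clear; lia.
  subst s; have g2 : g = 2 by move: gs2; rewrite expr1n mulr1.
  subst g; clear - e t0 a0 ha hs ht.
  (* Reducedness now reads [2*t <= a <= 3*t]. By the equation the product equals [2 - 2*t^2], so
     [t = 1]. *)
  have h : 0 <= (a - 2 * t) * (6 * t - a - 2 * t) by rewrite mulr_ge0 //; lia.
  have t1 : t = 1.
    apply/eqP; rewrite eq_le [1 <= t]t0 andbT leNgt; apply/negP => t1.
    have : 0 <= (t - 2) * (t + 2) by rewrite mulr_ge0 //; lia.
    by lia.
  subst t; have : (a - 2) * (a - 4) = 0 by lia.
  by move/eqP; rewrite mulf_eq0 => /orP[] /eqP; split=> //; lia.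
- have : 1 <= g * t ^+ 2 by rewrite -gtz0_ge1 mulr_gt0 // exprn_gt0.
  by move: Y9; rewrite /Y; clear; lia.
- by move: (lt_trans a3 Z9).
Qed.

(** Vieta: as a quadratic in [s] the equation has root sum [3*a*t] and a positive root product, so
    the other root is again a positive integer. The next two lemmas do the same in [t] and [a]. *)
Lemma markov_flip_s (g s t a : int) : 0 < g ->
  markov g s t a -> markov g (3 * a * t - s) t a.
Proof.
move=> g0 [s0 t0 a0 e]; split=> //; last by lia.
have : 0 < g * s * (3 * a * t - s).
  have -> : g * s * (3 * a * t - s) = a ^+ 2 + 3 * g * t ^+ 2 by lia.
  by rewrite addr_gt0 ?mulr_gt0 ?exprn_gt0.
by rewrite pmulr_rgt0 // mulr_gt0.
Qed.

Lemma markov_flip_t (g s t a : int) : 0 < g ->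
  markov g s t a -> markov g s (a * s - t) a.
Proof.
move=> g0 [s0 t0 a0 e]; split=> //; last by lia.
have : 0 < 3 * g * t * (a * s - t).
  have -> : 3 * g * t * (a * s - t) = a ^+ 2 + g * s ^+ 2 by lia.
  by rewrite addr_gt0 ?mulr_gt0 ?exprn_gt0.
by rewrite pmulr_rgt0 // !mulr_gt0.
Qed.

Lemma markov_flip_a (g s t a : int) : 0 < g ->
  markov g s t a -> markov g s t (3 * g * s * t - a).
Proof.
move=> g0 [s0 t0 a0 e]; split=> //; last by lia.
have : 0 < a * (3 * g * s * t - a).
  have -> : a * (3 * g * s * t - a) = g * (s ^+ 2 + 3 * t ^+ 2) by lia.
  by rewrite mulr_gt0 // addr_gt0 ?mulr_gt0 ?exprn_gt0.
by rewrite pmulr_rgt0.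
Qed.

(** Induction on [s + t + a]: a solution not covered by [markov_minimal] has a flip that lowers this
    sum. Each inductive hypothesis concerns the flipped solution. *)
Lemma markov_ind (g : int) (P : int -> int -> int -> Prop) :
  0 < g -> (g = 2 -> P 1 1 2) ->
  (forall s t a, markov g s t a -> P (3 * a * t - s) t a -> P s t a) ->
  (forall s t a, markov g s t a -> P s (a * s - t) a -> P s t a) ->
  (forall s t a, markov g s t a -> P s t (3 * g * s * t - a) -> P s t a) ->
  forall s t a, markov g s t a -> P s t a.
Proof.
move=> g0 P0 Ps Pt Pa s t a; have [n] := ubnP (absz (s + t + a)).
elim: n s t a => // n IHn s t a len m; have [s0 t0 a0 _] := m.
have [ha|ha] := leP (2 * a) (3 * g * s * t); last first.
  have m' := markov_flip_a g0 m; have [_ _ a0' _] := m'.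
  by apply: Pa => //; apply: IHn => //; lia.
have [hs|hs] := leP (2 * s) (3 * a * t); last first.
  have m' := markov_flip_s g0 m; have [s0' _ _ _] := m'.
  by apply: Ps => //; apply: IHn => //; lia.
have [ht|ht] := leP (2 * t) (a * s); last first.
  have m' := markov_flip_t g0 m; have [_ t0' _ _] := m'.
  by apply: Pt => //; apply: IHn => //; lia.
by have [g2 -> -> ->] := markov_minimal g0 m ha hs ht; apply: P0.
Qed.

(** The flips keep [g] fixed, and the descent can end only at [g = 2]. *)
Lemma markov_eq2 (g s t a : int) : 0 < g -> markov g s t a -> g = 2.
Proof. by move=> g0; move: s t a; apply: markov_ind. Qed.

(** * Lifting T to S *)

Lemma markov2_calS (s t a : int) :
  markov 2 s t a -> exists2 u, a = 2 * u & calS (s, t, u).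
Proof.
move=> m; have [s0 t0 a0 e] := m.
have /dvdzP[u au] : (2 %| a)%Z.
  have : (2 %| a ^+ 2)%Z.
    by apply/dvdzP; exists (3 * s * t * a - (s ^+ 2 + 3 * t ^+ 2)); lia.
  by rewrite !dvdzE abszX Euclid_dvdX // andbT.
subst a; exists u; first by rewrite mulrC.
split; [by split=> //; lia | | by lia].
set k := gcdz s t.
have [s' ss] := dvdzP (dvdz_gcdl s t : (k %| s)%Z).
have [t' tt] := dvdzP (dvdz_gcdr s t : (k %| t)%Z).
have k0 : 0 < k by rewrite /k /gcdz ltz_nat gcdn_gt0; lia.
(* Dividing [s] and [t] by their gcd [k] multiplies [g] by [k^2]. Since [g] can only be 2,
   [k = 1]. *)
have mk : markov (2 * k ^+ 2) s' t' (u * 2).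
  split=> //.
  - by move: s0; rewrite ss pmulr_lgt0.
  - by move: t0; rewrite tt pmulr_lgt0.
  - by move: e; rewrite ss tt; clear; lia.
have := markov_eq2 _ mk; rewrite mulr_gt0 ?exprn_gt0 // => /(_ isT) k1.
have : (k - 1) * (k + 1) = 0 by lia.
by move/eqP; rewrite mulf_eq0 => /orP[] /eqP; rewrite /coprimez -/k; lia.
Qed.

Lemma calS_markov2 (s t u : int) : calS (s, t, u) -> markov 2 s t (2 * u).
Proof. by move=> [[s0 t0 u0] _ e]; split=> //; lia. Qed.

(** * Factorizations of a square and of three times a square *)

Section ProductsOfSquares.
Local Open Scope nat_scope.

Lemma coprime_mul_sqr (x y m : nat) : 0 < x -> coprime x y -> x * y = m ^ 2 ->
  x = gcdn x m ^ 2.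
Proof.
move=> x0 cxy e; set d := gcdn x m.
have d0 : 0 < d by rewrite gcdn_gt0 x0.
have /dvdnP[x' xE] : d %| x by exact: dvdn_gcdl.
have /dvdnP[m' mE] : d %| m by exact: dvdn_gcdr.
have cxm : coprime x' m'.
  by rewrite /coprime -(eqn_pmul2r d0) muln_gcdl -xE -mE mul1n.
have e' : x' * y = d * m' ^ 2.
  apply/eqP; rewrite -(eqn_pmul2r d0); apply/eqP.
  by rewrite -mulnA [y * d]mulnC mulnA -xE e mE; lia.
suff x'd : x' = d by rewrite xE x'd mulnn.
apply/eqP; rewrite eqn_dvd; apply/andP; split.
  by rewrite -(Gauss_dvdl d (coprimeXr 2 cxm)) -e' dvdn_mulr.
have cdy : coprime d y by apply: coprime_dvdl cxy; apply: dvdn_gcdl.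
by rewrite -(Gauss_dvdl x' cdy) e' dvdn_mulr.
Qed.

(** Take [g = gcdn x y]. The coprime quotients multiply to [3*M^2], so one is a square and the other
    is three times a square; the two cases record which. *)
Lemma mul_eq_3sqr (x y m : nat) : 0 < x -> 0 < y -> x * y = 3 * m ^ 2 ->
  exists g s t, m = g * s * t /\
    (x = g * s ^ 2 /\ y = 3 * g * t ^ 2 \/ x = 3 * g * t ^ 2 /\ y = g * s ^ 2).
Proof.
move=> x0 y0 e; set g := gcdn x y.
have m0 : 0 < m by move: e; case: (m) => //; lia.
have g0 : 0 < g by rewrite gcdn_gt0 x0.
have [X xE] := dvdnP (dvdn_gcdl x y : g %| x).
have [Y yE] := dvdnP (dvdn_gcdr x y : g %| y).
have cXY : coprime X Y.
  by rewrite /coprime -(eqn_pmul2r g0) muln_gcdl -xE -yE mul1n.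
(* Once the gcd of [g] and [m] is cancelled, the square of what is left of [g] divides 3, so it is
   1. *)
have /dvdnP[M mE] : g %| m.
  set h := gcdn g m; have h0 : 0 < h by rewrite gcdn_gt0 g0.
  have [G gE] := dvdnP (dvdn_gcdl g m : h %| g).
  have [M mE] := dvdnP (dvdn_gcdr g m : h %| m).
  have cGM : coprime G M.
    by rewrite /coprime -(eqn_pmul2r h0) muln_gcdl -gE -mE mul1n.
  have e' : X * Y * G ^ 2 = 3 * M ^ 2.
    apply/eqP; rewrite -(@eqn_pmul2r (h ^ 2)) ?expn_gt0 ?h0 //; apply/eqP.
    have <- : 3 * (M * h) ^ 2 = 3 * M ^ 2 * h ^ 2 by ring.
    by rewrite -mE -e xE yE {1 2}gE; ring.
  have : G ^ 2 %| 3.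
    by rewrite -(Gauss_dvdl 3 (coprimeXl 2 (coprimeXr 2 cGM))) -e' dvdn_mull.
  move=> /dvdn_leq => /(_ isT); case: G gE {cGM e'} => [|[|G]] gE; last by lia.
    by move: g0; rewrite gE.
  by move=> _; rewrite gE mul1n; apply: dvdn_gcdr.
have e' : X * Y = 3 * M ^ 2.
  apply/eqP; rewrite -(@eqn_pmul2r (g ^ 2)) ?expn_gt0 ?g0 //; apply/eqP.
  have <- : 3 * (M * g) ^ 2 = 3 * M ^ 2 * g ^ 2 by ring.
  by rewrite -mE -e xE yE; ring.
have main (x' y' : nat) : 0 < x' -> 0 < y' -> coprime x' y' ->
    x' * y' = 3 * M ^ 2 -> 3 %| y' ->
    exists s t, [/\ M = s * t, x' = s ^ 2 & y' = 3 * t ^ 2].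
  move=> x'0 y'0 c exy /dvdnP[z zE]; subst y'.
  have cxz : coprime x' z by apply: coprime_dvdr c; rewrite dvdn_mulr.
  have xzE : x' * z = M ^ 2 by lia.
  have z0 : 0 < z by lia.
  have zx : z * x' = M ^ 2 by rewrite mulnC.
  have xs := coprime_mul_sqr x'0 cxz xzE.
  have zs := coprime_mul_sqr z0 (etrans (coprime_sym z x') cxz) zx.
  exists (gcdn x' M), (gcdn z M); split=> //; last by rewrite -zs mulnC.
  by apply/eqP; rewrite -(@eqn_exp2r _ _ 2) // -xzE {1}xs {1}zs expnMn.
have X0 : 0 < X by move: x0; rewrite xE muln_gt0 => /andP[].
have Y0 : 0 < Y by move: y0; rewrite yE muln_gt0 => /andP[].
have : 3 %| X * Y by rewrite e' dvdn_mulr.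
rewrite Euclid_dvdM // => /orP[d3|d3].
- have [s [t [Ms Ys Xt]]] :=
    main Y X Y0 X0 (etrans (coprime_sym Y X) cXY) (etrans (mulnC Y X) e') d3.
  exists g, s, t; split; first by rewrite mE Ms; ring.
  by right; rewrite xE yE Ys Xt; split; ring.
- have [s [t [Ms Xs Yt]]] := main X Y X0 Y0 cXY e' d3.
  exists g, s, t; split; first by rewrite mE Ms; ring.
  by left; rewrite xE yE Xs Yt; split; ring.
Qed.

End ProductsOfSquares.

Lemma calT_markov (a b : int) : calT (a, b) ->
  exists g s t, [/\ 0 < g, markov g s t a & b = 3 * g * s * t - a].
Proof.
move=> [a0 b0 ab [c]] e.
have sqr3 (z : int) : (3 %| z ^+ 2)%Z -> (3 %| z)%Z.
  by rewrite !dvdzE abszX Euclid_dvdX // andbT.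
have [d dE] : exists d, c = d * 3.
  apply/dvdzP/sqr3/dvdzP; exists (3 * a ^+ 2 * b ^+ 2 - 4 * (a + b) ^+ 2).
  by rewrite -e; ring.
have [m mE] : exists m, a + b = m * 3.
  apply/dvdzP/sqr3/dvdzP.
  exists (a ^+ 2 * b ^+ 2 - d ^+ 2 - (a + b) ^+ 2).
  by move: e; rewrite dE; clear; lia.
have e1 : (a * b - `|d|) * (a * b + `|d|) = 12 * m ^+ 2.
  have -> : (a * b - `|d|) * (a * b + `|d|) = (a * b) ^+ 2 - `|d| ^+ 2 by ring.
  by rewrite real_normK ?num_real //; move: e; rewrite dE mE; clear; lia.
have m0 : 0 < m by move: mE; clear -a0 b0; lia.
(* The two factors have the same parity and an even product, so both are even; [x] and [y] are their
   halves. *)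
have [x xE] : exists x, a * b - `|d| = x * 2.
  apply/dvdzP.
  have : (2 %| (a * b - `|d|) * (a * b + `|d|))%Z.
    by apply/dvdzP; exists (6 * m ^+ 2); rewrite e1; ring.
  rewrite [(2 %| _ * _)%Z]dvdzE abszM Euclid_dvdM // -!dvdzE => /orP[] // d2.
  have -> : a * b - `|d| = a * b + `|d| - `|d| * 2 by ring.
  by rewrite rpredB // dvdz_mull.
pose y := x + `|d|.
have xy : a * b = x + y by rewrite /y; move: xE; clear; lia.
have e2 : x * y = 3 * m ^+ 2 by move: e1 xE; rewrite xy /y; clear; lia.
have ab0 : 0 < x + y by rewrite -xy mulr_gt0.
have y0 : 0 < y by move: ab0; rewrite /y; clear; lia.
have x0 : 0 < x.
  have : 0 < x * y by rewrite e2 mulr_gt0 // exprn_gt0.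
  by rewrite pmulr_lgt0.
have [g [s [t [mst xyst]]]] : exists g s t : nat, `|m|%N = (g * s * t)%N /\
    (`|x|%N = g * s ^ 2 /\ `|y|%N = 3 * g * t ^ 2 \/
     `|x|%N = 3 * g * t ^ 2 /\ `|y|%N = g * s ^ 2)%N.
  apply: mul_eq_3sqr; [by lia | by lia |].
  by rewrite -abszM e2 abszM abszX.
have mst' : m = g%:Z * s%:Z * t%:Z.
  by rewrite -!PoszM -mst gez0_abs // ltW.
have xyst' : x + y = g%:Z * (s%:Z ^+ 2 + 3 * t%:Z ^+ 2).
  case: xyst => -[xs ys]; rewrite -(gtz0_abs x0) -(gtz0_abs y0) xs ys;
    by rewrite !PoszM; ring.
have [g0 s0 t0] : [/\ 0 < g, 0 < s & 0 < t]%N.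
  have : (0 < g * s * t)%N by rewrite -mst; lia.
  by rewrite !muln_gt0 -andbA => /and3P.
have bE : b = 3 * g%:Z * s%:Z * t%:Z - a.
  by have -> : b = (a + b) - a by [rewrite addrC addKr]; rewrite mE mst'; ring.
exists g%:Z, s%:Z, t%:Z; split=> //; split=> //.
by rewrite -xyst' -xy bE; ring.
Qed.

Lemma calT_lift (a b : int) : calT (a, b) ->
  exists s t u, [/\ calS (s, t, u), a = 2 * u & b = 6 * s * t - a].
Proof.
move=> Tab; have [g [s [t [g0 m bE]]]] := calT_markov Tab.
have g2 := markov_eq2 g0 m; subst g.
have [u au Su] := markov2_calS m.
by exists s, t, u; split.
Qed.

(** * Eisenstein integers *)

Definition sqrtm3 : algC := 'i * sqrtC 3.

Lemma sqrtm3_sqr : sqrtm3 ^+ 2 = - 3.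
Proof. by rewrite /sqrtm3 exprMn sqrCi sqrtCK mulN1r. Qed.

Lemma sqrtC3_real : sqrtC (3 : algC) \is Num.real.
Proof. by rewrite sqrtC_real // ler0n. Qed.

Lemma sqrtC3_gt0 : 0 < sqrtC (3 : algC).
Proof. by rewrite sqrtC_gt0 ltr0n. Qed.

Lemma conj_sqrtm3 : sqrtm3^* = - sqrtm3.
Proof. by rewrite /sqrtm3 rmorphM /= conjCi (CrealP sqrtC3_real) mulNr. Qed.

Lemma norm_sqrtm3 : `|sqrtm3| = sqrtC 3.
Proof.
by rewrite /sqrtm3 normrM normCi mul1r ger0_norm // ltW // sqrtC3_gt0.
Qed.

Lemma sqrtm3_omega : sqrtm3 = 2 * omega + 1.
Proof. by rewrite /sqrtm3 /omega; field. Qed.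

Lemma omega_sqr : omega ^+ 2 = - 1 - omega.
Proof.
apply: (@mulfI _ 4); first by rewrite pnatr_eq0.
have -> : 4 * omega ^+ 2 = (2 * omega + 1) ^+ 2 - 4 * omega - 1 by ring.
by rewrite -sqrtm3_omega sqrtm3_sqr; ring.
Qed.

Lemma conj_omega : omega^* = - 1 - omega.
Proof.
apply: (@mulfI _ 2); first by rewrite pnatr_eq0.
have := conj_sqrtm3.
rewrite sqrtm3_omega rmorphD rmorphM rmorph1 /= conjC_nat => e.
by have -> : 2 * omega^* = 2 * omega^* + 1 - 1 by [ring]; rewrite e; ring.
Qed.

Lemma eisenstein_int (n : int) : eisenstein n%:~R.
Proof. by exists n, 0; rewrite mul0r addr0. Qed.

Lemma eisenstein_sqrtm3 : eisenstein sqrtm3.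
Proof. by exists 1, 2; rewrite sqrtm3_omega addrC. Qed.

Lemma eisensteinD (z w : algC) :
  eisenstein z -> eisenstein w -> eisenstein (z + w).
Proof.
move=> [m [n ->]] [m' [n' ->]]; exists (m + m'), (n + n').
by rewrite !rmorphD /=; ring.
Qed.

Lemma eisensteinM (z w : algC) :
  eisenstein z -> eisenstein w -> eisenstein (z * w).
Proof.
move=> [m [n ->]] [m' [n' ->]].
exists (m * m' - n * n'), (m * n' + n * m' - n * n').
by rewrite !(rmorphD, rmorphB, rmorphM) /=; ring: omega_sqr.
Qed.

Lemma eisensteinN (z : algC) : eisenstein z -> eisenstein (- z).
Proof.
move=> Ez; rewrite -mulN1r.
by apply: eisensteinM => //; exact: (eisenstein_int (-1)).
Qed.

Lemma eisenstein_conj (z : algC) : eisenstein z -> eisenstein z^*.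
Proof.
move=> [m [n ->]]; exists (m - n), (- n).
by rewrite rmorphD rmorphM !rmorph_int /= conj_omega rmorphB rmorphN /=; ring.
Qed.

Lemma norm_eisenstein (m n : int) :
  `|m%:~R + n%:~R * omega| ^+ 2 = (m ^+ 2 - m * n + n ^+ 2)%:~R.
Proof.
rewrite normCK rmorphD rmorphM !rmorph_int /= conj_omega.
rewrite !(rmorphD, rmorphB, rmorphM, rmorphXn) /=; ring: omega_sqr.
Qed.

Lemma Im_sqrtm3 (x y : algC) : x \is Num.real -> y \is Num.real ->
  'Im (x + y * sqrtm3) = y * sqrtC 3.
Proof.
move=> xR yR; rewrite /sqrtm3 mulrCA Im_rect // realM ?sqrtC3_real //.
Qed.

Lemma Im_eisenstein (m n : int) :
  'Im (m%:~R + n%:~R * omega) = n%:~R / 2 * sqrtC 3.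
Proof.
have -> : m%:~R + n%:~R * omega = (m%:~R - n%:~R / 2) + (n%:~R / 2) * sqrtm3.
  by rewrite sqrtm3_omega; field.
by rewrite Im_sqrtm3 // ?realB ?realM ?realV ?Rreal_int ?realn // realz.
Qed.

(** * Equable parallelograms and pairs in T *)

Lemma perimeter_parallelogram (P Q R S : algC) : parallelogram P Q R S ->
  perimeter4 P Q R S = 2 * (`|Q - P| + `|S - P|).
Proof.
rewrite /parallelogram /perimeter4 => e.
have -> : R - Q = S - P by have -> : R = Q - P + S by [rewrite e subrK]; ring.
by rewrite (distrC S R) -e (distrC P S); ring.
Qed.

(** Write the conjugate of one side times the other as [j + k*omega]. Its norm gives
    [9*a^2*b^2 = j^2 - j*k + k^2], and equability fixes its imaginary part, giving
    [|k| = 4*(a + b)]. *)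
Lemma ELEP_calT (a b : int) : 0 < a -> 0 < b -> a < b ->
  ELEP_with_sides (a%:~R * sqrtC 3) (b%:~R * sqrtC 3) -> calT (a, b).
Proof.
move=> a0 b0 ab [P [Q [R [S [[[EP EQ _ ES] par _ eq] za wb]]]]].
split=> //.
have [j [k jk]] : eisenstein ((Q - P)^* * (S - P)).
  apply: eisensteinM; first apply: eisenstein_conj;
  by apply: eisensteinD => //; exact: eisensteinN.
have Njk : 9 * a ^+ 2 * b ^+ 2 = j ^+ 2 - j * k + k ^+ 2.
  apply: (intr_inj (R := algC)); rewrite -norm_eisenstein -jk.
  rewrite normrM norm_conjC za wb !exprMn !sqrtCK; ring.
have : `|k| = 4 * (a + b).
  apply: (intr_inj (R := algC)).
  move: eq; rewrite perimeter_parallelogram // za wb /parallelogram_area jk.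
  rewrite Im_eisenstein normrM (gtr0_norm sqrtC3_gt0) -mulrDl mulrA.
  move=> /(mulIf (lt0r_neq0 sqrtC3_gt0)).
  rewrite normrM normfV normr_nat -intr_norm => e.
  by rewrite -[LHS](divfK (x := 2)) ?pnatr_eq0 // -e rmorphM rmorphD /=; ring.
(* Completing the square, the norm is [(j - k/2)^2 + 3*k^2/4], where [3*k^2/4 = 12*(a + b)^2]. *)
move=> nk; have [kE|kE] : k = 4 * (a + b) \/ k = - (4 * (a + b)) by lia.
  by exists (j - 2 * (a + b)); move: Njk; rewrite kE; clear; lia.
by exists (j + 2 * (a + b)); move: Njk; rewrite kE; clear; lia.
Qed.

(** The pair [c], [d] is 1 and 2 in some order. Keeping both makes the condition symmetric: [d]
    plays for [be] and [6*s*t - a] the role that [c] plays for [al] and [a]. *)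
Definition eisenstein_factor (s t a : int) : Prop :=
  exists al be : algC, exists c d : int,
    [/\ [/\ eisenstein al, eisenstein be, 0 < c & 0 < d], c * d = 2,
        al * be = s%:~R + t%:~R * sqrtm3 & c%:~R * `|al| ^+ 2 = a%:~R].

Lemma norm_sqrtm3_rect (s t : int) :
  `|s%:~R + t%:~R * sqrtm3| ^+ 2 = (s ^+ 2 + 3 * t ^+ 2)%:~R.
Proof.
rewrite normCK rmorphD rmorphM !rmorph_int /= conj_sqrtm3.
rewrite !(rmorphD, rmorphM, rmorphXn) /=; ring: sqrtm3_sqr.
Qed.

(** Both sides times [a] equal [2*(s^2 + 3*t^2)]: the left one by multiplicativity of the norm, the
    right one by the equation. *)
Lemma eisenstein_cofactor (s t a c d : int) (al be : algC) :
  markov 2 s t a -> c * d = 2 -> al * be = s%:~R + t%:~R * sqrtm3 ->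
  c%:~R * `|al| ^+ 2 = a%:~R -> d%:~R * `|be| ^+ 2 = (6 * s * t - a)%:~R.
Proof.
move=> [_ _ a0 e] cd abE aE.
have a0' : (a%:~R : algC) != 0 by rewrite intr_eq0 gt_eqF.
apply: (mulfI a0'); rewrite -[in LHS]aE.
have -> : c%:~R * `|al| ^+ 2 * (d%:~R * `|be| ^+ 2)
  = (c * d)%:~R * `|al * be| ^+ 2 by rewrite normrM rmorphM /=; ring.
rewrite cd abE norm_sqrtm3_rect -!rmorphM; congr (_%:~R).
by move: e; clear; lia.
Qed.

Lemma markov2_eisenstein_factor (s t a : int) :
  markov 2 s t a -> eisenstein_factor s t a.
Proof.
move: s t a; apply: markov_ind => //.
- move=> _; exists 1, (1 + sqrtm3), 2, 1; split=> //.
  + split=> //; first exact: (eisenstein_int 1).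
    apply: eisensteinD; first exact: (eisenstein_int 1).
    exact: eisenstein_sqrtm3.
  + by rewrite !mul1r.
  + by rewrite normr1 expr1n mulr1.
- move=> s t a _ [al [be [c [d [[Ea Eb c0 d0] cd abE aE]]]]].
  (* Since [c * al * al^* = a], multiplying by [al^*] gives [3*t*a] minus the conjugate of
     [al * be], which undoes the flip of [s]. The flip of [t] is lifted likewise, with [s * sqrtm3]
     in place of [3*t]. *)
  exists al^*, (3 * t%:~R * c%:~R * al - be^*), c, d; split=> //.
  + split=> //; first exact: eisenstein_conj.
    apply: eisensteinD; last exact/eisensteinN/eisenstein_conj.
    apply: eisensteinM => //; rewrite -[3]/(3%:~R) -!rmorphM.
    exact: eisenstein_int.
  + have -> : al^* * (3 * t%:~R * c%:~R * al - be^*)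
      = 3 * t%:~R * (c%:~R * (al * al^*)) - (al * be)^*.
      by rewrite rmorphM /=; ring.
    rewrite -normCK aE abE rmorphD rmorphM !rmorph_int /= conj_sqrtm3.
    by rewrite rmorphB !rmorphM /=; ring.
  + by rewrite norm_conjC.
- move=> s t a _ [al [be [c [d [[Ea Eb c0 d0] cd abE aE]]]]].
  exists al^*, (s%:~R * sqrtm3 * c%:~R * al + be^*), c, d; split=> //.
  + split=> //; first exact: eisenstein_conj.
    apply: eisensteinD; last exact/eisenstein_conj.
    by repeat first [exact: eisenstein_int | exact: eisenstein_sqrtm3 |
    assumption | apply: eisensteinM].
  + have -> : al^* * (s%:~R * sqrtm3 * c%:~R * al + be^*)
      = s%:~R * sqrtm3 * (c%:~R * (al * al^*)) + (al * be)^*.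
      by rewrite rmorphM /=; ring.
    rewrite -normCK aE abE rmorphD rmorphM !rmorph_int /= conj_sqrtm3.
    by rewrite rmorphB !rmorphM /=; ring.
  + by rewrite norm_conjC.
- move=> s t a m [al [be [c [d [[Ea Eb c0 d0] cd abE aE]]]]].
  (* The flip of [a] exchanges the two factors. *)
  exists be, al, d, c; split=> //; first by rewrite mulrC.
    by rewrite mulrC.
  rewrite (eisenstein_cofactor (markov_flip_a _ m) cd abE aE) //.
  by congr (_%:~R); ring.
Qed.

Lemma calT_ELEP (a b : int) : calT (a, b) ->
  ELEP_with_sides (a%:~R * sqrtC 3) (b%:~R * sqrtC 3).
Proof.
move=> Tab; have [s [t [u [Su au bE]]]] := calT_lift Tab.
have m : markov 2 s t a by rewrite au; exact: calS_markov2.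
have [s0 t0 a0 _] := m.
have [al [be [c [d [[Ea Eb c0 d0] cd abE aE]]]]] := markov2_eisenstein_factor m.
have := eisenstein_cofactor m cd abE aE; rewrite -bE => {}bE'.
(* The lengths are [sqrtC 3] times [c*|al|^2 = a] and [d*|be|^2 = b]. Moreover
   [z^* * w = 6*(s + t*sqrtm3)^2] has imaginary part [12*s*t*sqrtC 3], which is the perimeter
   because [a + b = 6*s*t]. *)
pose z := (c%:~R * sqrtm3 * al ^+ 2)^*; pose w := - (d%:~R * sqrtm3 * be ^+ 2).
have Ez : eisenstein z.
  apply: eisenstein_conj.
  by repeat first [exact: eisenstein_int | exact: eisenstein_sqrtm3 |
    assumption | apply: eisensteinM].
have Ew : eisenstein w.
  apply: eisensteinN.
  by repeat first [exact: eisenstein_int | exact: eisenstein_sqrtm3 |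
    assumption | apply: eisensteinM].
have E0 : eisenstein 0 by exact: (eisenstein_int 0).
have nz : `|z| = a%:~R * sqrtC 3.
  have cR : 0 <= c%:~R :> algC by rewrite ler0z ltW.
  rewrite /z norm_conjC normrM normrX normrM norm_sqrtm3 -aE (ger0_norm cR).
  by ring.
have nw : `|w| = b%:~R * sqrtC 3.
  have dR : 0 <= d%:~R :> algC by rewrite ler0z ltW.
  rewrite /w normrN normrM normrX normrM norm_sqrtm3 -bE' (ger0_norm dR).
  by ring.
have area : `|'Im (z^* * w)| = (12 * s * t)%:~R * sqrtC 3.
  have -> : z^* * w =
      (6 * (s ^+ 2 - 3 * t ^+ 2))%:~R + (12 * s * t)%:~R * sqrtm3.
    have -> : z^* * w = - (c * d)%:~R * sqrtm3 ^+ 2 * (al * be) ^+ 2.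
      by rewrite /z conjCK /w rmorphM /=; ring.
    rewrite cd abE !(rmorphM, rmorphB, rmorphXn) /=; ring: sqrtm3_sqr.
  rewrite Im_sqrtm3 ?realz // ger0_norm // mulr_ge0 ?(ltW sqrtC3_gt0) //.
  by rewrite ler0z ltW // !mulr_gt0.
exists 0, z, (z + w), w; split; last 2 first.
- by rewrite subr0.
- by rewrite subr0.
have par : parallelogram 0 z (z + w) w by rewrite /parallelogram subr0 addrK.
split=> //.
- by split=> //; exact: eisensteinD.
- rewrite /parallelogram_area !subr0 area mulf_neq0 ?(lt0r_neq0 sqrtC3_gt0) //.
  by rewrite intr_eq0 gt_eqF // !mulr_gt0.
- rewrite perimeter_parallelogram // /parallelogram_area !subr0 area nz nw bE.
  by rewrite rmorphB !rmorphM /=; ring.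
Qed.

(** * Trees from height functions *)

Lemma exists_max_seq (T : eqType) (h : T -> nat) (x : T) (c : seq T) :
  exists2 m, m \in x :: c & forall y, y \in x :: c -> (h y <= h m)%N.
Proof.
elim: c x => [|y c IHc] x.
  by exists x => [|z /[1!inE]/eqP->]; rewrite ?inE.
have [m mc mmax] := IHc y.
have [xm|mx] := leqP (h x) (h m).
  by exists m => [|z]; rewrite inE ?mc ?orbT // => /orP[/eqP->|/mmax].
exists x => [|z]; rewrite inE ?eqxx // => /orP[/eqP->//|/mmax zm].
exact: leq_trans zm (ltnW mx).
Qed.

(** Descending to lower neighbours connects every vertex to [r]. On a cycle, both neighbours of a
    highest vertex are lower, hence equal, which is impossible when the length exceeds 2. *)
Lemma tree_of_height (V : eqType) (G : simple_graph V) (h : V -> nat) (r : V) :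
  (forall v w, adj G v w -> h v != h w) ->
  (forall v, v != r -> exists2 w, adj G v w & (h w < h v)%N) ->
  (forall v w w', adj G v w -> adj G v w' ->
     (h w < h v)%N -> (h w' < h v)%N -> w = w') ->
  is_tree G.
Proof.
move=> hadj hpar huniq; split; first by exists r.
  have conn_sym v w : (exists2 p, path (adj G) v p & last v p = w) ->
      exists2 p, path (adj G) w p & last w p = v.
    move=> [p pp <-]; exists (rev (belast v p)).
      by rewrite rev_path; under eq_path do rewrite adj_sym.
    by case: p {pp} => //= x p; rewrite rev_cons last_rcons.
  have conn_root v : exists2 p, path (adj G) v p & last v p = r.
    have [n] := ubnP (h v); elim: n v => // n IHn v hv.
    have [->|vr] := eqVneq v r; first by exists [::].
    have [w vw wv] := hpar _ vr.
    have [p pp pr] := IHn w (leq_trans wv hv).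
    by exists (w :: p); rewrite /= ?vw.
  move=> v w; have [p pp pr] := conn_root v.
  have [p' pp' pr'] := conn_sym _ _ (conn_root w).
  by exists (p ++ p'); rewrite ?cat_path ?last_cat ?pr ?pp.
move=> c cc; apply/negP => c2.
have [m mc mmax] : exists2 m, m \in c & forall y, y \in c -> (h y <= h m)%N.
  by case: c {cc} c2 => // x c _; apply: exists_max_seq.
(* Rotate the cycle so that the highest vertex [m] comes first; its neighbours are then the second
   entry [x] and the last entry [z]. *)
have [i c' rotc] := rot_to mc.
have mem_c' x : x \in c' -> x \in c.
  by move=> xc; rewrite -(mem_rot i c) rotc inE xc orbT.
have : (2 < size (m :: c'))%N by rewrite -rotc size_rot.
move: cc; rewrite -(rot_ucycle i) rotc => /andP[].
case: c' {rotc} mem_c' => [|x [|y c']] // mem_c' cyc uc _.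
move: cyc; rewrite /= rcons_path => /and3P[mx _ /andP[_ zm]].
set z := last y c' in zm.
have zc' : z \in y :: c' by exact: mem_last.
have lower w : adj G m w -> w \in [:: x, y & c'] -> (h w < h m)%N.
  by move=> mw wc; rewrite ltn_neqAle eq_sym hadj //= mmax // mem_c'.
have xz : x = z.
  rewrite adj_sym in zm.
  by apply: (huniq m) => //; apply: lower => //; rewrite inE ?eqxx ?zc' ?orbT.
by move: uc; rewrite /= xz zc' andbF.
Qed.

(** * The graph on T *)

(** The value [s^2 + 3*t^2 = 2*u*(3*s*t - u)] is unchanged by [u -> 3*s*t - u]. So [s^2], [3*t^2]
    and [s'^2], [3*t'^2] have the same sum and product, and [s^2] is [s'^2] or [3*t'^2]. *)
Lemma calS_base_uniq (s t u s' t' u' : int) :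
  calS (s, t, u) -> calS (s', t', u') -> s * t = s' * t' ->
  u' = u \/ u + u' = 3 * s * t -> s = s' /\ t = t'.
Proof.
move=> [[s0 t0 u0] _ e] [[s'0 t'0 u'0] _ e'] st uu.
have ss : s ^+ 2 + 3 * t ^+ 2 = s' ^+ 2 + 3 * t' ^+ 2.
  have e1 : s ^+ 2 + 3 * t ^+ 2 = 2 * u * (3 * (s * t) - u).
    by move: e; clear; lia.
  have -> : s' ^+ 2 + 3 * t' ^+ 2 = 2 * u' * (3 * (s' * t') - u').
    by move: e'; clear; lia.
  rewrite e1 -st; case: uu => [->//|uu].
  have -> : u' = 3 * s * t - u by rewrite -uu addrC addKr.
  by ring.
have : (s - s') * ((s + s') * (s ^+ 2 - 3 * t' ^+ 2)) = 0.
  have : s ^+ 2 * (s ^+ 2 + 3 * t ^+ 2) - 3 * (s * t) ^+ 2 = s ^+ 4 by ring.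
  rewrite ss st => E; have : s ^+ 4 = s ^+ 4 by [].
  by rewrite -{1}E; clear; lia.
move/eqP; rewrite !mulf_eq0 !subr_eq0 (gt_eqF (addr_gt0 s0 s'0)) /=.
move=> /orP[/eqP e1|].
  by subst s'; split=> //; apply: (mulfI (lt0r_neq0 s0)).
(* s^2 = 3t'^2 is impossible by 3-adic valuation. *)
move=> /eqP e1; have /(congr1 (fun z : int => logn 3 `|z|%N)) := e1.
rewrite abszM !abszX lognM // ?expn_gt0 ?absz_gt0 ?lt0r_neq0 // !lognX.
by rewrite [logn 3 `|3| ]logn_prime //=; lia.
Qed.

Lemma val_pi (x : calS) : val (pi x) =
  let: (s, t, u) := val x in
  (3 * s * t - `|3 * s * t - 2 * u|, 3 * s * t + `|3 * s * t - 2 * u|).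
Proof.
case: x => [[[s t] u] Sx] /=.
by rewrite /pi_fun (pi_algE (set_mem Sx)) /= !intrKfloor.
Qed.

Lemma pi_fibre (x y : calS) : pi x = pi y ->
  (val x).1 = (val y).1 /\
  ((val x).2 = (val y).2 \/
   (val x).2 + (val y).2 = 3 * (val x).1.1 * (val x).1.2).
Proof.
move=> /(congr1 val); rewrite !val_pi.
case: x y => [[[s t] u] Sx] [[[s' t'] u'] Sy] /= [e1 e2].
have st : s * t = s' * t' by lia.
have uu : u = u' \/ u + u' = 3 * s * t by lia.
have [ss tt] : s = s' /\ t = t'.
  apply: (calS_base_uniq (set_mem Sx) (set_mem Sy) st).
  by case: uu => [->|]; [left|right].
by split=> //; rewrite ss tt.
Qed.

(** Existence of a lift shows that the [xget] in [liftq] and [liftr] never falls back on its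
    default; [pi_fibre] then identifies the chosen points. *)
Lemma calT_fibre (v : calT) : exists s t q r : int,
  [/\ val (liftq v) = (s, t, q), val (liftr v) = (s, t, r),
      q < r, q + r = 3 * s * t & val v = (2 * q, 2 * r)] /\
  [/\ pi (liftq v) = v & pi (liftr v) = v].
Proof.
have [a [b vE]] : exists a b, val v = (a, b).
  by case: (val v) => a b; exists a, b.
have Tab : calT (a, b) by rewrite -vE; exact: set_mem (valP v).
have [_ _ ab _] := Tab.
have [s [t [q [Sq aq bE]]]] := calT_lift Tab.
pose r : int := 3 * s * t - q.
have Sr : calS (s, t, r).
  have [[s0 t0 q0] cst e] := Sq; split=> //.
    by split=> //; rewrite /r; lia.
  by rewrite /r; move: e; clear; lia.
have ex : [set x : calS | 2 * (val x).2 = (val v).1 /\ pi x = v]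
    (exist _ (s, t, q) (mem_set Sq)).
  split; first by rewrite vE aq.
  by apply: val_inj; rewrite val_pi vE /=; congr pair; lia.
have [lq piq] : 2 * (val (liftq v)).2 = (val v).1 /\ pi (liftq v) = v.
  by rewrite /liftq; exact: (xgetI rootS ex).
have lqE : val (liftq v) = (s, t, q).
  have e : pi (liftq v) = pi (exist _ (s, t, q) (mem_set Sq)).
    by rewrite piq ex.2.
  have [] := pi_fibre e; case: (val (liftq v)) lq => st q' /=.
  by rewrite vE /= => lq -> _; congr pair; lia.
have [lr1 lr2] : (val (liftr v)).1 = (val (liftq v)).1 /\
    2 * (val (liftr v)).2 = (val v).2.
  rewrite /liftr; apply: (@xgetPex _ rootS [set y : calS |
    (val y).1 = (val (liftq v)).1 /\ 2 * (val y).2 = (val v).2]).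
  exists (exist _ (s, t, r) (mem_set Sr)); split; first by rewrite lqE.
  by rewrite vE /= /r; lia.
have lrE : val (liftr v) = (s, t, r).
  move: lr1 lr2; rewrite lqE vE; case: (val (liftr v)) => st r' /= -> ?.
  by congr pair; rewrite /r; lia.
exists s, t, q, r; split; split=> //; try by rewrite /r; lia.
- by rewrite vE /r; congr pair; lia.
- by apply: val_inj; rewrite val_pi lrE vE /= /r; congr pair; lia.
Qed.

(* The pair (s, t) shared by the two points of the fibre above v. *)
Definition base (v : calT) : int * int := (val (liftq v)).1.

Lemma base_pi (x : calS) : base (pi x) = (val x).1.
Proof.
have [s [t [q [r [_ [e _]]]]]] := calT_fibre (pi x).
by have [] := pi_fibre e.
Qed.

Lemma pi_liftq (v : calT) : pi (liftq v) = v.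
Proof. by have [s [t [q [r [_ []]]]]] := calT_fibre v. Qed.

Lemma pi_liftr (v : calT) : pi (liftr v) = v.
Proof. by have [s [t [q [r [_ []]]]]] := calT_fibre v. Qed.

Lemma fibre_lift (x : calS) (v : calT) : pi x = v -> x = liftq v \/ x = liftr v.
Proof.
have [s [t [q [r [[lq lr qr qrE _] [pq _]]]]]] := calT_fibre v.
move=> xv; have [] := pi_fibre (etrans xv (esym pq)); rewrite lq /=.
move: (x) => -[[[s' t'] u] Sx] /= [ss tt] uu; subst s' t'.
have [uq|ur] : u = q \/ u = r by lia.
  by left; apply: val_inj; rewrite lq /= uq.
by right; apply: val_inj; rewrite lr /= ur.
Qed.

(** Only [liftq v] and [liftr v] lie above [v], so the edges at [v] come from the four maps. *)
Lemma edgeTE (v w : calT) : edgeT v w =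
  (v != w) && (w \in [:: varphi1 v; varphi2 v; psi1 v; psi2 v]).
Proof.
rewrite /edgeT; case: (v != w) => //=; rewrite !inE.
apply/asboolP/idP => [[x /fibre_lift]|].
  by move=> [->|->] [<-|<-];
    rewrite -/(varphi1 v) -/(varphi2 v) -/(psi1 v) -/(psi2 v) eqxx ?orbT.
move=> /or4P[] /eqP->.
- by exists (liftq v); [exact: pi_liftq | left].
- by exists (liftq v); [exact: pi_liftq | right].
- by exists (liftr v); [exact: pi_liftr | left].
- by exists (liftr v); [exact: pi_liftr | right].
Qed.

(** * Heights of the neighbours of a vertex *)

Definition height (v : calT) : nat := absz ((base v).1 * (base v).2).

Lemma pi_rootS : pi rootS = rootT.
Proof. by apply: val_inj; rewrite val_pi. Qed.

Lemma base_root : base rootT = (1, 1).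
Proof. by rewrite -pi_rootS base_pi. Qed.

Lemma calT_neighbours (v : calT) : exists s t q r : int,
  [/\ calS (s, t, q), calS (s, t, r), q < r & q + r = 3 * s * t] /\
  [/\ base v = (s, t), base (varphi1 v) = (6 * t * q - s, t),
      base (varphi2 v) = (s, 2 * s * q - t),
      base (psi1 v) = (6 * t * r - s, t) &
      base (psi2 v) = (s, 2 * s * r - t)].
Proof.
have [s [t [q [r [[lq lr qr qrE _] _]]]]] := calT_fibre v.
have Sq : calS (s, t, q) by rewrite -lq; exact: set_mem (valP (liftq v)).
have Sr : calS (s, t, r) by rewrite -lr; exact: set_mem (valP (liftr v)).
have e1 x : val (phi1 x) = phi1_fun (val x) by [].
have e2 x : val (phi2 x) = phi2_fun (val x) by [].
exists s, t, q, r; split=> //; rewrite /varphi1 /varphi2 /psi1 /psi2 !base_pi.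
by rewrite !e1 !e2 /base lq lr.
Qed.

(** The larger root satisfies [2*r > 3*s*t], so [6*t*r > 9*s*t^2 >= 9*s] and
    [2*s*r > 3*s^2*t >= 3*t]. *)
Lemma calS_flips_gt (s t q r : int) : calS (s, t, q) -> q < r ->
  q + r = 3 * s * t -> s < 6 * t * r - s /\ t < 2 * s * r - t.
Proof.
move=> [[s0 t0 q0] _ _] qr qrE.
have hr : 3 * (s * t) < 2 * r by lia.
have t1 : 1 <= t ^+ 2 by rewrite -gtz0_ge1 exprn_gt0.
have s1 : 1 <= s ^+ 2 by rewrite -gtz0_ge1 exprn_gt0.
split.
  have : 3 * t * (3 * (s * t)) < 3 * t * (2 * r).
    by rewrite ltr_pM2l // mulr_gt0.
  have : s * 1 <= s * t ^+ 2 by rewrite ler_pM2l.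
  by move: s0; clear; lia.
have : s * (3 * (s * t)) < s * (2 * r) by rewrite ltr_pM2l.
have : t * 1 <= t * s ^+ 2 by rewrite ler_pM2l.
by move: t0; clear; lia.
Qed.

(** With [q] the smaller root, flipping [u] does not descend. If neither other flip descends,
    [markov_minimal] gives the root; both cannot descend, as [s > 3*t*q] and [t > s*q] are
    incompatible. *)
Lemma calS_flips_lt (s t q : int) : calS (s, t, q) -> 2 * q < 3 * s * t ->
  [\/ s = 1 /\ t = 1, 6 * t * q - s < s /\ t < 2 * s * q - t |
      s < 6 * t * q - s /\ 2 * s * q - t < t].
Proof.
move=> Sq qst; have [[s0 t0 q0] _ e] := Sq.
have [hs|hs] := leP s (3 * t * q); last first.
  constructor 2; split; first by lia.
  have tq : 0 <= (t - 1) * (q - 1) by rewrite mulr_ge0 //; lia.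
  have sq : 0 <= (q - 1) * s by rewrite mulr_ge0 //; lia.
  have tq' : 0 <= t * (q - 1) by rewrite mulr_ge0 //; lia.
  have -> : 2 * s * q - t = 2 * ((q - 1) * s) + 2 * s - t by ring.
  by lia.
have [ht|ht] := leP t (s * q).
  constructor 1.
  by have [||||_ -> ->] // := markov_minimal _ (calS_markov2 Sq); lia.
constructor 3; split; last by lia.
have sq : 0 <= s * (q - 1) by rewrite mulr_ge0 //; lia.
have tq : 0 <= t * (q - 1) by rewrite mulr_ge0 //; lia.
lia.
Qed.

Lemma base_eq_root (v : calT) : base v = (1, 1) -> v = rootT.
Proof.
have [s [t [q [r [[lq _ qr qrE vE] _]]]]] := calT_fibre v.
have := set_mem (valP (liftq v)).
rewrite /base lq /= => -[[_ _ q0] _ _] [s1 t1].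
apply: val_inj; rewrite vE /=; move: qrE; rewrite s1 t1 => qrE.
by congr pair; lia.
Qed.

Lemma height_neighbours (v : calT) :
  [/\ (height v < height (psi1 v))%N, (height v < height (psi2 v))%N &
   if v == rootT then varphi2 v = v /\ (height v < height (varphi1 v))%N
   else (height (varphi1 v) < height v < height (varphi2 v))%N
     \/ (height (varphi2 v) < height v < height (varphi1 v))%N].
Proof.
have [s [t [q [r [[Sq Sr qr qrE] [bv b1 b2 b3 b4]]]]]] := calT_neighbours v.
have [g1 g2] := calS_flips_gt Sq qr qrE.
have [[s0 t0 q0] _ _] := Sq.
(* A neighbour shares one coordinate of the base with [v], so comparing heights amounts to comparing
   the other one. *)
have mono (x y z : int) : 0 < z -> 0 < x -> 0 < y ->
    ((absz (x * z)%R < absz (y * z)%R)%N = (x < y)) *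
    ((absz (z * x)%R < absz (z * y)%R)%N = (x < y)).
  move=> z0 x0 y0; rewrite -!ltz_nat !gtz0_abs ?mulr_gt0 //.
  by rewrite ltr_pM2l ?ltr_pM2r.
have [[p1 _ _] _ _] := phi1_funS Sq; have [[_ p2 _] _ _] := phi2_funS Sq.
have [[p3 _ _] _ _] := phi1_funS Sr; have [[_ p4 _] _ _] := phi2_funS Sr.
rewrite /height bv b1 b2 b3 b4 /= !mono //; split=> //.
have [vr|vr] := eqVneq v rootT.
  move: bv; rewrite vr base_root => -[s1 t1]; subst s t.
  have q1 : q = 1.
    have : (q - 1) * (q - 2) = 0 by have [_ _] := Sq; lia.
    by move/eqP; rewrite mulf_eq0 => /orP[] /eqP; lia.
  subst q; split=> //; apply: base_eq_root; rewrite -vr b2 //.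
have [|[s1 t1]|[h1 h2]|[h1 h2]] := calS_flips_lt Sq; first by lia.
- by case/eqP: vr; apply: base_eq_root; rewrite bv s1 t1.
- by left; rewrite h1.
- by right; rewrite h2.
Qed.

Lemma neighbours_uniq (v : calT) :
  uniq (map base [:: varphi1 v; varphi2 v; psi1 v; psi2 v]).
Proof.
have [s [t [q [r [[Sq Sr qr qrE] [bv b1 b2 b3 b4]]]]]] := calT_neighbours v.
have [g1 g2] := calS_flips_gt Sq qr qrE.
have [[s0 t0 q0] _ _] := Sq.
have n1 : t * q < t * r by rewrite ltr_pM2l.
have n2 : s * q < s * r by rewrite ltr_pM2l.
(* Coincidence would give [varphi1 v] and [varphi2 v] equal heights, contradicting
   [height_neighbours]. *)
have n3 : ~~ ((6 * t * q - s == s) && (t == 2 * s * q - t)).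
  rewrite -xpair_eqE -b1 -b2; apply/eqP => e12.
  have [_ _] := height_neighbours v; rewrite /height e12.
  by case: eqP => [_ [-> ]|_ []]; lia.
by rewrite /= b1 b2 b3 b4 !inE !xpair_eqE; lia.
Qed.

Lemma height_adj (v w : calT) : edgeT v w -> height v != height w.
Proof.
rewrite edgeTE => /andP[vw]; have [h3 h4] := height_neighbours v.
rewrite !inE; case: eqP => [vr [h2 h1]|_ h12] /or4P[] /eqP wE; subst w;
  try by rewrite ltn_eqF.
  by rewrite h2 eqxx in vw.
all: by case: h12 => /andP[]; lia.
Qed.

Lemma height_parent (v : calT) : v != rootT ->
  exists2 w, edgeT v w & (height w < height v)%N.
Proof.
move=> vr; have [_ _] := height_neighbours v; rewrite (negPf vr).
case=> /andP[h _]; [exists (varphi1 v) | exists (varphi2 v)] => //;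
  by rewrite edgeTE !inE eqxx ?orbT andbT; apply: contraTneq h => <-;
    rewrite ltnn.
Qed.

Lemma height_parent_uniq (v w w' : calT) : edgeT v w -> edgeT v w' ->
  (height w < height v)%N -> (height w' < height v)%N -> w = w'.
Proof.
have [h3 h4] := height_neighbours v.
rewrite !edgeTE !inE; case: eqP => [vr [h2 h1]|_ h12] /andP[_ hw] /andP[_ hw'].
  by move: hw => /or4P[] /eqP->; rewrite ?h2; lia.
by move: hw hw' => /or4P[] /eqP-> /or4P[] /eqP-> //; lia.
Qed.

(** * Degrees, generation from the root and infinitude *)

Lemma has_degree_seq (V : choiceType) (G : simple_graph V) (v : V) (s : seq V) :
  uniq s -> (forall w, adj G v w = (w \in s)) -> has_degree G v (size s).
Proof.
move=> us vs; rewrite /has_degree.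
have -> : [set w | adj G v w] = [set` [fset x in s]%fset].
  by apply/seteqP; split=> w /=; rewrite vs inE.
by apply/card_eq_fsetP; rewrite card_fseq undup_id.
Qed.

(** The root is fixed by [varphi2], which therefore contributes no edge there. *)
Lemma degree_root : has_degree graphT rootT 3.
Proof.
have := map_uniq (neighbours_uniq rootT).
have [h3 h4] := height_neighbours rootT; move=> [h2 h1].
rewrite /= !inE !negb_or -!andbA => /and4P[_ n13 n14 /and4P[_ _ n34 _]].
apply: (@has_degree_seq _ graphT _ [:: varphi1 rootT; psi1 rootT; psi2 rootT]).
  by rewrite /= !inE !negb_or n13 n14 n34.
move=> w; rewrite /= edgeTE !inE h2 [rootT == w]eq_sym.
have [->|//] := eqVneq w rootT; rewrite /=; apply/esym/negbTE.
by apply/negP => /or3P[] /eqP e; move: h1 h3 h4; rewrite -e ltnn.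
Qed.

Lemma degree_nonroot (v : calT) : v != rootT -> has_degree graphT v 4.
Proof.
move=> vr; have [h3 h4] := height_neighbours v; rewrite (negPf vr) => h12.
apply: (has_degree_seq (map_uniq (neighbours_uniq v))) => w.
rewrite /= edgeTE; have [<-|//] := eqVneq v w; rewrite /=; apply/esym/negbTE.
rewrite !inE; apply/negP => /or4P[] /eqP e; move: h3 h4 h12; rewrite -e; lia.
Qed.

Lemma generated_root (v : calT) :
  generated [set f | [\/ f = varphi1, f = varphi2, f = psi1 | f = psi2]]
    rootT v.
Proof.
have [n] := ubnP (height v); elim: n v => // n IHn v hv.
have [->|vr] := eqVneq v rootT; first exact: generated_base.
have [w vw wv] := height_parent vr.
have {}IHn := IHn w (leq_trans wv hv).
(* Read from the lower vertex [w], the edge exhibits [v] as the image of [w] under one of the four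
   maps. *)
move: vw; rewrite edgeT_sym edgeTE => /andP[_]; rewrite !inE.
by move=> /or4P[] /eqP->; apply: generated_step => //=;
  [constructor 1|constructor 2|constructor 3|constructor 4].
Qed.

(** Iterating [psi1] from the root strictly raises the height, which embeds the natural numbers in
    T. *)
Lemma calT_infinite : infinite_set [set: calT].
Proof.
pose f n := iter n psi1 rootT.
have hf : {homo height \o f : i j / (i < j)%N}.
  apply: homo_ltn; first exact: ltn_trans.
  by move=> n /=; have [] := height_neighbours (f n).
have finj : injective f.
  move=> i j e; have := hf i j; have := hf j i; rewrite /= e ltnn.
  by case: ltngtP => // _ h1 h2; [have := h1 isT | have := h2 isT].
apply/infiniteP; rewrite -(preimage_setT f).
by apply: card_ge_preimage => i j _ _; exact: finj.
Qed.

Theorem mainTheorem4 :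
  (forall a b : int, 0 < a -> 0 < b -> a < b ->
     (calT (a, b) <->
      ELEP_with_sides (a%:~R * sqrtC 3) (b%:~R * sqrtC 3))) /\
  [/\ infinite_set [set: calT],
      is_tree graphT,
      has_degree graphT rootT 3,
      (forall v : calT, v != rootT -> has_degree graphT v 4) &
      (forall v : calT,
         generated [set f | [\/ f = varphi1, f = varphi2, f = psi1 | f = psi2]]
           rootT v)].
Proof.
split.
  by move=> a b a0 b0 ab; split; [exact: calT_ELEP | exact: ELEP_calT].
split.
- exact: calT_infinite.
- exact: (@tree_of_height _ graphT height rootT
    height_adj height_parent height_parent_uniq).
- exact: degree_root.
- exact: degree_nonroot.
- exact: generated_root.
Qed.
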